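(* Let $P \subseteq [0,1]^n$ be a solvable, down-closed convex body, let $G\colon [0,1]^n \to \mathbb{R}$ be a non-negative $L$-smooth DR-submodular function, let $C\colon [0,1]^n \to \mathbb{R}$ be a non-negative $L$-smooth concave function, and let $F = G + C$. Let $\mathbf{o} \in \arg\max_{\mathbf{x}\in P} F(\mathbf{x})$, $D = \max_{\mathbf{x}\in P}\|\mathbf{x}\|_2$, and let $\varepsilon \in (0,1)$ be such that $\varepsilon^{-1}$ is an integer. Let $S$ be the time it takes to find a point in $P$ maximizing a given linear function. Then the algorithm Measured Greedy Frank-Wolfe (defined in the context) with parameter $\varepsilon$ runs in $O(\varepsilon^{-1}(n+S))$ time, makes $O(1/\varepsilon)$ calls to the gradient oracle (of $F$), and outputs a vector $\mathbf{y}$ such that $$F(\mathbf{y}) \ge \alpha\cdot G(\mathbf{o}) + \beta\cdot C(\mathbf{o}) - O(\varepsilon L D^2),$$ where $\alpha = 1-e^{-1}$ if $G$ is monotone and $\alpha = e^{-1}$ otherwise, and $\beta = 1-e^{-1}$ if $C$ is monotone and $\beta = e^{-1}$ otherwise.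
   Context: Inequalities between vectors hold coordinate-wise; $\langle\cdot,\cdot\rangle$ is the standard Euclidean inner product; $\odot$ is coordinate-wise multiplication; $\mathbf{e}_i$ is the $i$-th standard basis vector. A function $G\colon[0,1]^n\to\mathbb{R}$ is DR-submodular if for all $\mathbf{a},\mathbf{b}\in[0,1]^n$ with $\mathbf{a}\le\mathbf{b}$, every $k>0$ and every $i\in\{1,\dots,n\}$ with $\mathbf{a}+k\mathbf{e}_i,\mathbf{b}+k\mathbf{e}_i\in[0,1]^n$, one has $G(\mathbf{a}+k\mathbf{e}_i)-G(\mathbf{a})\ge G(\mathbf{b}+k\mathbf{e}_i)-G(\mathbf{b})$. A function $f$ is $L$-smooth if it is differentiable and $\|\nabla f(\mathbf{a})-\nabla f(\mathbf{b})\|_2\le L\|\mathbf{a}-\mathbf{b}\|_2$ for all $\mathbf{a},\mathbf{b}\in[0,1]^n$. A function $f$ is monotone if $\mathbf{a}\le\mathbf{b}$ implies $f(\mathbf{a})\le f(\mathbf{b})$. $P$ is solvable if one can efficiently optimize linear functions over it; $P$ is down-closed if $\mathbf{0}\le\mathbf{x}\le\mathbf{y}$ and $\mathbf{y}\in P$ imply $\mathbf{x}\in P$. $O(\cdot)$ hides universal constants; gradient-oracle calls are counted separately from the running time. Algorithm Measured Greedy Frank-Wolfe ($\varepsilon$): set $t\gets 0$ and $\mathbf{y}^{(0)}\gets\mathbf{0}$ (all-zeros vector). While $t<1$: let $\mathbf{s}^{(t)}\in\arg\max_{\mathbf{x}\in P}\langle(\mathbf{1}-\mathbf{y}^{(t)})\odot\nabla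 F(\mathbf{y}^{(t)}),\mathbf{x}\rangle$, where $\mathbf{1}$ is the all-ones vector; set $\mathbf{y}^{(t+\varepsilon)}\gets\mathbf{y}^{(t)}+\varepsilon\cdot(\mathbf{1}-\mathbf{y}^{(t)})\odot\mathbf{s}^{(t)}$; set $t\gets t+\varepsilon$. Return $\mathbf{y}^{(1)}$. *)

(* Defs.v *)
From mathcomp Require Import all_boot all_order all_algebra.
From mathcomp Require Import all_classical all_reals all_analysis.
Import Order.TTheory GRing.Theory Num.Theory.
Import numFieldNormedType.Exports.

Set Implicit Arguments.
Unset Strict Implicit.
Unset Printing Implicit Defensive.

Local Open Scope classical_set_scope.
Local Open Scope ring_scope.
Local Open Scope convex_scope.

(* Functions on [0,1]^n are total functions on 'rV[R]_n; every predicate below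
   constrains them on the cube only. *)

Section Vectors.
Context {R : realType} {n : nat}.
Implicit Types (a b u v w x y : 'rV[R]_n) (f : 'rV[R]_n -> R).

Definition dot u v : R := \sum_(i < n) u 0 i * v 0 i.

(* The library norm `|x| on 'rV[R]_n is the max norm. *)
Definition l2norm x : R := Num.sqrt (\sum_(i < n) x 0 i ^+ 2).

Definition vle a b := forall i : 'I_n, a 0 i <= b 0 i.

Definition cube : set 'rV[R]_n := [set x | forall i : 'I_n, 0 <= x 0 i <= 1].

Definition argmax (A : set 'rV[R]_n) f : set 'rV[R]_n :=
  [set x | A x /\ forall z, A z -> f z <= f x].

(* Empty interior is allowed. *)
Definition convex_body (P : set 'rV[R]_n) :=
  [/\ P !=set0, compact P & convex_set P].

Definition down_closed (P : set 'rV[R]_n) :=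
  forall x y, vle 0 x -> vle x y -> P y -> P x.

Definition nonneg f := forall x, cube x -> 0 <= f x.

Definition monotone f := forall a b, cube a -> cube b -> vle a b -> f a <= f b.

Definition dr_submodular f :=
  forall a b (k : R) (i : 'I_n), cube a -> cube b -> vle a b -> 0 < k ->
    cube (a + k *: delta_mx 0 i) -> cube (b + k *: delta_mx 0 i) ->
    f (b + k *: delta_mx 0 i) - f b <= f (a + k *: delta_mx 0 i) - f a.

Definition concave f :=
  forall t : {i01 R}, {in cube &, forall x y : convex_lmodType 'rV[R]_n,
    (f x : R^o) <| t |> (f y : R^o) <= f (x <| t |> y)}.

(* df is the gradient of f on the cube. The increments are restricted to the
   cube, as f is only meant to be defined there; for 0 < n the cube has
   nonempty interior, so df is determined on it by f. *)
Definition is_gradient f (df : 'rV[R]_n -> 'rV[R]_n) :=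
  forall a, cube a ->
    (fun b => f b - f a - dot (df a) (b - a) : R^o)
      =o_ (within cube (nbhs a)) (fun b => b - a).

Definition smooth (L : R) f :=
  exists2 df, is_gradient f df &
    forall a b, cube a -> cube b -> l2norm (df a - df b) <= L * l2norm (a - b).

Definition approx_factor f : R :=
  if `[< monotone f >] then 1 - expR (-1) else expR (-1).

(* solver w x tau: on input w, a run of the solver may return x after tau
   steps. The argmax need not be unique, so the solver may be nondeterministic. *)
Definition solves_within (S : nat) (P : set 'rV[R]_n)
    (solver : 'rV[R]_n -> 'rV[R]_n -> nat -> Prop) :=
  forall w, (exists x tau, solver w x tau) /\
    forall x tau, solver w x tau -> argmax P (dot w) x /\ (tau <= S)%N.

End Vectors.

(* A real-number random access machine: real variables, index variables and
   arrays of reals, all named by natural numbers. The programs mention neither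
   R nor n; the dimension is visible only through the guard IdxInDim. *)

Inductive expr :=
  | Lit of nat
  | Var of nat
  | At of nat & nat                       (* At a i is the cell a[i] *)
  | Add of expr & expr
  | Sub of expr & expr
  | Mul of expr & expr.

Inductive guard :=
  | Less of expr & expr
  | IdxInDim of nat.                      (* the index variable is < n *)

Inductive cmd :=
  | SetVar of nat & expr
  | SetAt of nat & nat & expr             (* SetAt a i e is a[i] := e *)
  | ZeroIdx of nat
  | IncrIdx of nat
  | Seq of cmd & cmd
  | While of guard & cmd
  | LinMax of nat & nat                   (* LinMax s w is s := solver(w) *)
  | Grad of nat & nat.                    (* Grad g y is g := oracle(y) *)

Fixpoint expr_cost (e : expr) : nat :=
  match e with
  | Lit _ | Var _ | At _ _ => 1
  | Add e1 e2 | Sub e1 e2 | Mul e1 e2 => (expr_cost e1 + expr_cost e2).+1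
  end.

Definition guard_cost (g : guard) : nat :=
  match g with
  | Less e1 e2 => (expr_cost e1 + expr_cost e2).+1
  | IdxInDim _ => 1
  end.

Record state (R : realType) := State {
  var : nat -> R;
  idx : nat -> nat;
  arr : nat -> nat -> R;
  time : nat;
  grad_calls : nat
}.

Section Semantics.
Context {R : realType} {n : nat}.
Implicit Types (st : state R) (Q : state R -> Prop).

Definition vec (b : nat -> R) : 'rV[R]_n := \row_(i < n) b i.

Fixpoint eval st (e : expr) : R :=
  match e with
  | Lit k => k%:R
  | Var x => var st x
  | At a i => arr st a (idx st i)
  | Add e1 e2 => eval st e1 + eval st e2
  | Sub e1 e2 => eval st e1 - eval st e2
  | Mul e1 e2 => eval st e1 * eval st e2
  end.

Definition holds st (g : guard) : bool :=
  match g with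
  | Less e1 e2 => eval st e1 < eval st e2
  | IdxInDim i => (idx st i < n)%N
  end.

Definition tick (k : nat) st : state R :=
  State (var st) (idx st) (arr st) (time st + k) (grad_calls st).

Definition set_var (x : nat) (r : R) st : state R :=
  State [eta var st with x |-> r] (idx st) (arr st) (time st) (grad_calls st).

Definition set_idx (i k : nat) st : state R :=
  State (var st) [eta idx st with i |-> k] (arr st) (time st) (grad_calls st).

Definition set_arr (a : nat) (b : nat -> R) st : state R :=
  State (var st) (idx st) [eta arr st with a |-> b] (time st) (grad_calls st).

Definition set_at (a k : nat) (r : R) st : state R :=
  set_arr a [eta arr st a with k |-> r] st.

Definition count_grad st : state R :=
  State (var st) (idx st) (arr st) (time st) (grad_calls st).+1.

Variables (solver : 'rV[R]_n -> 'rV[R]_n -> nat -> Prop)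
          (oracle : 'rV[R]_n -> 'rV[R]_n).

(* ensures c st Q: every run of c from st terminates, in a state satisfying Q
   (total correctness over all choices of the solver). In Seq and While, Q1 is
   an intermediate assertion. An array returned by the solver or the oracle is
   arbitrary outside its first n cells. Oracle calls take no time and are
   counted in grad_calls. *)
Inductive ensures : cmd -> state R -> (state R -> Prop) -> Prop :=
  | ensures_set_var x e st Q :
      Q (tick (expr_cost e).+1 (set_var x (eval st e) st)) ->
      ensures (SetVar x e) st Q
  | ensures_set_at a i e st Q :
      Q (tick (expr_cost e).+1 (set_at a (idx st i) (eval st e) st)) ->
      ensures (SetAt a i e) st Q
  | ensures_zero_idx i st Q :
      Q (tick 1 (set_idx i 0 st)) ->
      ensures (ZeroIdx i) st Q
  | ensures_incr_idx i st Q :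
      Q (tick 1 (set_idx i (idx st i).+1 st)) ->
      ensures (IncrIdx i) st Q
  | ensures_seq c1 c2 st Q1 Q :
      ensures c1 st Q1 -> (forall st1, Q1 st1 -> ensures c2 st1 Q) ->
      ensures (Seq c1 c2) st Q
  | ensures_while_done g c st Q :
      ~~ holds st g -> Q (tick (guard_cost g) st) ->
      ensures (While g c) st Q
  | ensures_while_step g c st Q1 Q :
      holds st g -> ensures c (tick (guard_cost g) st) Q1 ->
      (forall st1, Q1 st1 -> ensures (While g c) st1 Q) ->
      ensures (While g c) st Q
  | ensures_lin_max s w st Q :
      (exists x tau, solver (vec (arr st w)) x tau) ->
      (forall b tau, solver (vec (arr st w)) (vec b) tau ->
         Q (tick tau (set_arr s b st))) ->
      ensures (LinMax s w) st Q
  | ensures_grad g y st Q :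
      (forall b, vec b = oracle (vec (arr st y)) ->
         Q (count_grad (set_arr g b st))) ->
      ensures (Grad g y) st Q.

End Semantics.

Definition for_dim (i : nat) (c : cmd) : cmd :=
  Seq (ZeroIdx i) (While (IdxInDim i) (Seq c (IncrIdx i))).

(* Names of the variables of the algorithm: reals eps and t, index j, and
   arrays y, g (gradient), w (linear objective) and s (its maximizer). *)
Definition v_eps : nat := 0.
Definition v_t : nat := 1.
Definition i_j : nat := 0.
Definition a_y : nat := 0.
Definition a_g : nat := 1.
Definition a_w : nat := 2.
Definition a_s : nat := 3.

(* Measured Greedy Frank-Wolfe. The input is in v_eps, the output in a_y. *)
Definition measured_greedy_fw : cmd :=
  Seq (SetVar v_t (Lit 0))
 (Seq (for_dim i_j (SetAt a_y i_j (Lit 0)))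
      (While (Less (Var v_t) (Lit 1))
        (Seq (Grad a_g a_y)
        (Seq (for_dim i_j
                (SetAt a_w i_j
                   (Mul (Sub (Lit 1) (At a_y i_j)) (At a_g i_j))))
        (Seq (LinMax a_s a_w)
        (Seq (for_dim i_j
                (SetAt a_y i_j
                   (Add (At a_y i_j)
                        (Mul (Var v_eps)
                             (Mul (Sub (Lit 1) (At a_y i_j))
                                  (At a_s i_j))))))
             (SetVar v_t (Add (Var v_t) (Var v_eps))))))))).

(* Main.v *)
Require Import Defs.
From mathcomp Require Import all_boot all_order all_algebra.
From mathcomp Require Import all_classical all_reals all_analysis.
From mathcomp Require Import ring lra zify.
Import Order.TTheory GRing.Theory Num.Theory.
Import numFieldNormedType.Exports.

Set Implicit Arguments.
Unset Strict Implicit.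
Unset Printing Implicit Defensive.

Local Open Scope classical_set_scope.
Local Open Scope ring_scope.
Local Open Scope convex_scope.

(** Write [damp y s] for the coordinate-wise product of [1 - y] and [s], so that
    one iteration moves [y] to [y + eps *: damp y s], and let [H] be [G] or [C].

    DR-submodular and concave functions are both concave along nonnegative
    directions, and differentiability turns this into [tangent_bounds]: between
    comparable points, [H] increases by at least the slope at the upper end and
    at most the slope at the lower end. Everything else about [H] follows from
    these bounds, from nonnegativity and from the Lipschitz gradient.

    The lower bound gives [smooth_increment]: an iteration increases [H] by
    [eps] times the slope along [damp y s], up to [eps ^+ 2 * L * D ^+ 2]. By
    the choice of [s], the total slope of [F = G + C] along [damp y s] is at
    least the one along [damp y o]; and by the upper bound the slope of [H]
    along [damp y o] is at least [H (y + damp y o) - H y]. Finally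
    [H (y + damp y o)] is at least [H o] if [H] is monotone. In general it is at
    least [q * H o] with [q = (1 - eps) ^+ i] at iteration [i]
    ([rate_le_damp]), because the coordinates of [y] are then at most [1 - q]
    and the segment from [o] through [y + damp y o] can be prolonged inside the
    cube until the latter sits at a fraction [1 - q] of it.

    So [F] gains in each iteration a fraction [eps] of the gap between
    [rate G q * G o + rate C q * C o] and [F y], up to
    [2 * eps ^+ 2 * L * D ^+ 2] ([measured_greedy_step]). The recurrence has the
    closed form [guarantee], which after [eps^-1] iterations is at least
    [1 - expR (-1)] or [expR (-1)] ([approx_factor_le_guarantee]), while the
    errors add up to [2 * eps * L * D ^+ 2].

    The resource bounds come from executing the program symbolically: an
    iteration makes one call to the gradient oracle, one call to the solver and
    two passes over the coordinates. The analysis enters this execution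
    ([measured_greedy_fw_ensures]) as an abstract property of the iterates,
    which is then instantiated by [reached]. *)

(** * Inner products *)

Section DotProduct.
Context {R : realType} {n : nat}.
Implicit Types (u v w : 'rV[R]_n) (c : R).

Lemma dotDl u v w : dot (u + v) w = dot u w + dot v w.
Proof. by rewrite /dot -big_split; apply: eq_bigr => i _; rewrite mxE mulrDl. Qed.

Lemma dotBl u v w : dot (u - v) w = dot u w - dot v w.
Proof. by rewrite /dot -sumrB; apply: eq_bigr => i _; rewrite !mxE mulrBl. Qed.

Lemma dotZr c u v : dot u (c *: v) = c * dot u v.
Proof. by rewrite /dot mulr_sumr; apply: eq_bigr => i _; rewrite mxE; ring. Qed.

Lemma l2norm_ge0 u : 0 <= l2norm u.
Proof. exact: sqrtr_ge0. Qed.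

Lemma sqr_l2norm u : l2norm u ^+ 2 = dot u u.
Proof. by rewrite sqr_sqrtr// sumr_ge0// => i _; rewrite sqr_ge0. Qed.

Lemma dotvv_eq0 u : dot u u = 0 -> u = 0.
Proof.
move=> uu0; apply/rowP => i; rewrite mxE; apply/eqP; rewrite -sqrf_eq0 expr2.
apply/eqP; apply: (psumr_eq0P _ uu0) => // j _.
by rewrite -expr2 sqr_ge0.
Qed.

Lemma l2normN u : l2norm (- u) = l2norm u.
Proof. by rewrite /l2norm; under eq_bigr do rewrite mxE sqrrN. Qed.

Lemma l2normZ c u : 0 <= c -> l2norm (c *: u) = c * l2norm u.
Proof.
move=> c0; have uu : dot (c *: u) (c *: u) = c ^+ 2 * dot u u.
  by rewrite /dot mulr_sumr; apply: eq_bigr => i _; rewrite !mxE; ring.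
by rewrite -[LHS]ger0_norm ?l2norm_ge0// -sqrtr_sqr sqr_l2norm uu sqrtrM
  ?sqr_ge0// sqrtr_sqr ger0_norm// -sqr_l2norm sqrtr_sqr ger0_norm ?l2norm_ge0.
Qed.

(** The squared length of [dot v v *: u - dot u v *: v], the component of [u]
    orthogonal to [v] up to scaling, is [dot v v] times the Cauchy-Schwarz gap. *)
Lemma cauchy_schwarz u v : dot u v <= l2norm u * l2norm v.
Proof.
have [vv0|vv_neq0] := eqVneq (dot v v) 0.
  rewrite (dotvv_eq0 vv0) /dot big1 => [|i _]; last by rewrite mxE mulr0.
  by rewrite mulr_ge0 ?l2norm_ge0.
have vv_gt0 : 0 < dot v v by rewrite lt_def vv_neq0 -sqr_l2norm sqr_ge0.
apply: le_trans (ler_norm _) _.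
rewrite -(@ler_pXn2r _ 2) ?nnegrE ?mulr_ge0 ?l2norm_ge0// exprMn !sqr_l2norm.
rewrite real_normK ?num_real// -subr_ge0 -(pmulr_rge0 _ vv_gt0).
have -> : dot v v * (dot u u * dot v v - dot u v ^+ 2) =
    \sum_(i < n) (dot v v * u 0 i - dot u v * v 0 i) ^+ 2.
  have sqE i : (dot v v * u 0 i - dot u v * v 0 i) ^+ 2 =
      dot v v ^+ 2 * (u 0 i * u 0 i) - 2 * dot v v * dot u v * (u 0 i * v 0 i)
      + dot u v ^+ 2 * (v 0 i * v 0 i) by ring.
  rewrite (eq_bigr _ (fun i _ => sqE i)) big_split sumrB -!mulr_sumr /=.
  by rewrite -!/(dot _ _); ring.
by apply: sumr_ge0 => i _; rewrite sqr_ge0.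
Qed.

End DotProduct.

(** * Gradients on the cube and concavity along nonnegative directions *)

Section Gradient.
Context {R : realType} {n : nat}.
Implicit Types (f H : 'rV[R]_n -> R) (df dH : 'rV[R]_n -> 'rV[R]_n).
Implicit Types (a b v x y : 'rV[R]_n).

Lemma cube_segment a b (t : R) : cube a -> cube b -> 0 <= t <= 1 ->
  cube (a + t *: (b - a)).
Proof.
move=> ca cb /andP[t0 t1] i; have := ca i; have := cb i; rewrite !mxE.
by move=> /andP[? ?] /andP[? ?]; apply/andP; split; nra.
Qed.

Lemma invS_itv (N : nat) : 0 <= (N.+1%:R^-1 : R) <= 1.
Proof. by rewrite invr_ge0 ler0n/= invf_le1 ?ltr0n// ler1n. Qed.

(** Directional derivatives are taken along the sequence of steps
    [1 / N.+1]: submodularity compares increments over equal steps, so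
    it bounds the increment over an N-th of a segment by telescoping. *)
Lemma gradient_cvg f df a b : is_gradient f df -> cube a -> cube b ->
  (fun N => N.+1%:R * (f (a + N.+1%:R^-1 *: (b - a)) - f a)) @ \oo
    --> dot (df a) (b - a).
Proof.
move=> grad ca cb; apply/cvgrPdist_le => e e0.
have b0 : 0 < `|b - a| + 1 by rewrite ltr_wpDl.
have /eqoP /(_ _ (divr_gt0 e0 b0)) := grad a ca.
set Q := (X in \forall x \near _, X x) => near_a.
have cvg_a : (fun N => a + harmonic N *: (b - a)) @ \oo --> a.
  rewrite -[X in _ --> X]addr0 -(scale0r (b - a)).
  by apply: cvgD; [exact: cvg_cst | apply: cvgZr_tmp; exact: cvg_harmonic].
have {}near_a : \forall x \near a, cube x -> Q x by exact: near_a.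
near=> N.
have : cube (a + harmonic N *: (b - a)) -> Q (a + harmonic N *: (b - a)).
  near: N; exact: cvg_a near_a.
rewrite /Q/= /harmonic => /(_ (cube_segment ca cb (invS_itv N))).
have N0 : 0 < N.+1%:R :> R by rewrite ltr0n.
rewrite [a + _ - a]addrAC subrr add0r dotZr normrZ => bound.
rewrite distrC.
have -> : N.+1%:R * (f (a + N.+1%:R^-1 *: (b - a)) - f a) - dot (df a) (b - a)
  = N.+1%:R * (f (a + N.+1%:R^-1 *: (b - a)) - f a
      - N.+1%:R^-1 * dot (df a) (b - a)).
  by rewrite [RHS]mulrBr mulVKf ?gt_eqF.
rewrite normrM gtr0_norm//.
apply: (le_trans (ler_wpM2l (ltW N0) bound)).
rewrite gtr0_norm ?invr_gt0// mulrCA mulVKf ?gt_eqF//.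
rewrite -[leRHS](divfK (lt0r_neq0 b0)) ler_pM2l ?divr_gt0//.
by rewrite lerDl.
Unshelve. all: by end_near.
Qed.

(** On the boundary of the cube a gradient is still determined in the
    directions that stay in the cube, which is all the algorithm looks at. *)
Lemma gradient_add f g df dg dfg a b :
  is_gradient f df -> is_gradient g dg -> is_gradient (fun x => f x + g x) dfg ->
  cube a -> cube b -> dot (dfg a) (b - a) = dot (df a + dg a) (b - a).
Proof.
move=> gf gg gfg ca cb.
pose quot h N := N.+1%:R * (h (a + N.+1%:R^-1 *: (b - a)) - h a) : R.
have cvg_sum : quot f \+ quot g @ \oo --> dot (df a + dg a) (b - a).
  by rewrite dotDl; apply: cvgD; exact: gradient_cvg.
rewrite -(cvg_lim (@Rhausdorff R) cvg_sum).
rewrite -(cvg_lim (@Rhausdorff R) (gradient_cvg gfg ca cb)).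
by congr (lim (_ @ \oo)); apply/funext => N; rewrite /quot /=; ring.
Qed.

(** The first-order form of concavity along nonnegative directions, the
    property that DR-submodular and concave functions share. *)
Definition tangent_bounds H dH := forall a b, cube a -> cube b -> vle a b ->
  dot (dH b) (b - a) <= H b - H a <= dot (dH a) (b - a).

(** The first and the last of the N-th parts of a segment have slopes that tend
    to the derivatives at its two ends, so this reduces the tangent bounds to
    inequalities between values of [H]. *)
Lemma tangent_bounds_of_parts H dH : is_gradient H dH ->
  (forall a b N, cube a -> cube b -> vle a b ->
     N.+1%:R * (H b - H (b + N.+1%:R^-1 *: (a - b))) <= H b - H a <=
     N.+1%:R * (H (a + N.+1%:R^-1 *: (b - a)) - H a)) ->
  tangent_bounds H dH.
Proof.
move=> grad parts a b ca cb ab; apply/andP; split; last first.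
  apply: (cvgr_to_ge (gradient_cvg grad ca cb)); apply: nearW => N.
  by have /andP[] := parts a b N ca cb ab.
rewrite -(opprB a b) -scaleN1r dotZr mulN1r -lerN2 opprK opprB.
apply: (cvgr_to_ge (gradient_cvg grad cb ca)); apply: nearW => N.
have /andP[+ _] := parts a b N ca cb ab.
by rewrite -lerN2 opprB -mulrN opprB.
Qed.

Lemma concave_tangent_bounds H dH : is_gradient H dH -> concave H ->
  tangent_bounds H dH.
Proof.
move=> grad conc; apply: tangent_bounds_of_parts => // a b N ca cb ab.
have N0 : 0 < N.+1%:R :> R by rewrite ltr0n.
have chord x y : cube x -> cube y ->
    H y - H x <= N.+1%:R * (H (x + N.+1%:R^-1 *: (y - x)) - H x).
  move=> cx cy; have /andP[t0 t1] := invS_itv N.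
  have := conc (Itv01 t0 t1) y x; rewrite !inE => /(_ cy cx).
  rewrite convRE/=.
  have -> : (y : convex_lmodType 'rV[R]_n) <| Itv01 t0 t1 |> x =
      x + N.+1%:R^-1 *: (y - x).
    rewrite [LHS]/(N.+1%:R^-1 *: y + (1 - N.+1%:R^-1) *: x).
    by rewrite scalerBl scale1r scalerBr addrCA.
  move=> mid; rewrite -ler_pdivrMl//; move: mid; rewrite /unstable.onem => mid.
  by rewrite lerBrDr; apply: le_trans mid; rewrite mulrBr mulrBl mul1r -addrA (addrC (H x)).
rewrite chord// andbT -lerN2 opprB.
by apply: le_trans (chord b a cb ca) _; rewrite -mulrN opprB.
Qed.

(** Moving along [w] one coordinate at a time reduces this to the
    coordinate increments of the definition. *)
Lemma dr_diminishing H a b w : dr_submodular H -> cube a -> vle a b ->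
  vle 0 w -> cube (b + w) -> H (b + w) - H b <= H (a + w) - H a.
Proof.
move=> dr ca ab w0 cbw.
pose part k : 'rV[R]_n := \row_i (if (i < k)%N then w 0 i else 0).
have part_ge0 k i : 0 <= part k 0 i.
  by rewrite mxE; case: ifP => // _; have := w0 i; rewrite mxE.
have part_le k i : part k 0 i <= w 0 i.
  by rewrite mxE; case: ifP => // _; have := w0 i; rewrite mxE.
have cube_part x k : vle a x -> vle x b -> cube (x + part k).
  move=> ax xb i; rewrite mxE; have /andP[a0 _] := ca i.
  have /andP[_] := cbw i; rewrite mxE => bw1.
  have := part_ge0 k i; have := part_le k i; have := ax i; have := xb i.
  by move=> ? ? ? ?; apply/andP; split; lra.
have aa : vle a a by [].
have bb : vle b b by [].
suff diminishing k : (k <= n)%N ->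
    H (b + part k) - H b <= H (a + part k) - H a.
  have <- : part n = w by apply/rowP => i; rewrite mxE ltn_ord.
  exact: diminishing.
elim: k => [_|k IH kn].
  have -> : part 0%N = 0 by apply/rowP => i; rewrite !mxE.
  by rewrite !addr0 !subrr.
pose j := Ordinal kn.
have partS : part k.+1 = part k + w 0 j *: delta_mx 0 j.
  apply/rowP => i; rewrite !mxE eqxx/= ltnS leq_eqVlt.
  have [->|ij] := eqVneq i j; first by rewrite /= eqxx ltnn mulr1 add0r.
  by rewrite mulr0 addr0 -[k]/(val j) (inj_eq val_inj) (negPf ij).
have {}IH := IH (ltnW kn).
have [wj0|wj_neq0] := eqVneq (w 0 j) 0; first by rewrite partS wj0 scale0r addr0.
have wj_gt0 : 0 < w 0 j by rewrite lt_def wj_neq0; have := w0 j; rewrite mxE.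
have := dr (a + part k) (b + part k) (w 0 j) j; rewrite -!addrA -partS.
move=> /(_ (cube_part _ _ aa ab) (cube_part _ _ ab bb) _ wj_gt0).
move=> /(_ _ (cube_part _ _ aa ab) (cube_part _ _ ab bb)) step.
have : vle (a + part k) (b + part k) by move=> i; rewrite !mxE lerD2r; exact: ab.
by move/step; move: IH; lra.
Qed.

(** Cut the segment into equal parts: by diminishing returns the increments over
    them decrease, so their sum lies between multiples of the last and of the
    first one. *)
Lemma dr_tangent_bounds H dH : is_gradient H dH -> dr_submodular H ->
  tangent_bounds H dH.
Proof.
move=> grad dr; apply: tangent_bounds_of_parts => // a b N ca cb ab.
have N0 : N.+1%:R != 0 :> R by rewrite pnatr_eq0.
have Ninv0 : 0 <= N.+1%:R^-1 :> R by rewrite invr_ge0.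
pose v := N.+1%:R^-1 *: (b - a); pose pt k := a + k%:R *: v.
have ptS k : pt k.+1 = pt k + v by rewrite /pt -addrA -natr1 scalerDl scale1r.
have pt0 : pt 0%N = a by rewrite /pt scale0r addr0.
have ptN : pt N.+1 = b by rewrite /pt scalerA mulfV// scale1r addrC subrK.
have v0 : vle 0 v by move=> i; rewrite !mxE mulr_ge0// subr_ge0; exact: ab.
have cube_pt k : (k <= N.+1)%N -> cube (pt k).
  move=> kN; rewrite /pt scalerA; apply: cube_segment => //.
  by rewrite mulr_ge0//= ler_pdivrMr ?ltr0n// mul1r ler_nat.
pose incr k := H (pt k.+1) - H (pt k).
have incr_anti k l : (k <= l <= N)%N -> incr l <= incr k.
  move=> /andP[kl lN]; rewrite /incr !ptS; apply: dr_diminishing => //.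
  - by apply: cube_pt; exact: leq_trans kl (leqW lN).
  - move=> i; rewrite mxE [leRHS]mxE lerD2l mxE [leRHS]mxE.
    by apply: ler_wpM2r; [have := v0 i; rewrite mxE | rewrite ler_nat].
  - by rewrite -ptS; exact: cube_pt.
have sum_incr : H b - H a = \sum_(k < N.+1) incr k.
  rewrite -(big_mkord xpredT incr) telescope_sumr// ptN pt0.
  by [].
have const_sum (x : R) : N.+1%:R * x = \sum_(k < N.+1) x.
  by rewrite sumr_const card_ord mulr_natl.
have -> : b + N.+1%:R^-1 *: (a - b) = pt N.
  apply: (addIr v); rewrite -ptS ptN -addrA -scalerDr -(opprB b a) addNr.
  by rewrite scaler0 addr0.
have -> : a + N.+1%:R^-1 *: (b - a) = pt 1%N by rewrite ptS pt0.
have -> : H b - H (pt N) = incr N by rewrite /incr ptN.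
have -> : H (pt 1%N) - H a = incr 0%N by rewrite /incr pt0.
rewrite sum_incr !const_sum; apply/andP; split; apply: ler_sum => k _.
  by apply: incr_anti; rewrite leqnn -ltnS ltn_ord.
by apply: incr_anti; rewrite leq0n -ltnS ltn_ord.
Qed.

End Gradient.

(** * One step of the algorithm *)

Section FrankWolfe.
Context {R : realType} {n : nat}.
Implicit Types (H : 'rV[R]_n -> R) (dH : 'rV[R]_n -> 'rV[R]_n).
Implicit Types (a b o s v x y z : 'rV[R]_n) (L q t eps : R).

Definition damp y s : 'rV[R]_n := \row_(i < n) ((1 - y 0 i) * s 0 i).

Lemma damp_ge0 y s : cube y -> cube s -> vle 0 (damp y s).
Proof.
move=> cy cs i; rewrite !mxE; have /andP[_ y1] := cy i; have /andP[s0 _] := cs i.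
by rewrite mulr_ge0// subr_ge0.
Qed.

Lemma cube_damp y s : cube y -> cube s -> cube (y + damp y s).
Proof.
move=> cy cs i; rewrite !mxE; have /andP[? ?] := cy i; have /andP[? ?] := cs i.
by apply/andP; split; nra.
Qed.

Lemma cube_damped_step y s eps : cube y -> cube s -> 0 <= eps <= 1 ->
  cube (y + eps *: damp y s).
Proof.
move=> cy cs eps01; have := cube_segment cy (cube_damp cy cs) eps01.
by rewrite [y + _ - y]addrC addKr.
Qed.

Lemma addr_dampC y s : y + damp y s = s + damp s y.
Proof. by apply/rowP => i; rewrite !mxE; ring. Qed.

Lemma l2norm_damp y s : cube y -> l2norm (damp y s) <= l2norm s.
Proof.
move=> cy; apply: ler_wsqrtr; apply: ler_sum => i _; rewrite mxE exprMn.
have /andP[y0 y1] := cy i; apply: ler_piMl; first exact: sqr_ge0.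
by rewrite expr_le1 ?subr_ge0// gerBl.
Qed.

Lemma vle_addr y v : vle 0 v -> vle y (y + v).
Proof. by move=> v0 i; rewrite mxE lerDl; have := v0 i; rewrite mxE. Qed.

Lemma vle_scale t v : 0 <= t -> vle 0 v -> vle 0 (t *: v).
Proof. by move=> t0 v0 i; rewrite !mxE mulr_ge0//; have := v0 i; rewrite mxE. Qed.

Definition lipschitz_on_cube L dH := forall a b, cube a -> cube b ->
  l2norm (dH a - dH b) <= L * l2norm (a - b).

(** In dimension [0] the cube is a single point and [L] could be negative. *)
Lemma lipschitz_on_cube_ge0 L dH : (0 < n)%N -> lipschitz_on_cube L dH -> 0 <= L.
Proof.
move=> n0 lip.
have c0 : cube (0 : 'rV[R]_n) by move=> i; rewrite mxE lexx ler01.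
have c1 : cube (const_mx 1 : 'rV[R]_n) by move=> i; rewrite mxE lexx ler01.
have := le_trans (l2norm_ge0 _) (lip _ _ c1 c0); rewrite pmulr_lge0//.
rewrite subr0 sqrtr_gt0 (eq_bigr (fun=> 1)) => [|i _]; last by rewrite mxE expr1n.
by rewrite sumr_const card_ord ltr0n.
Qed.

(** The increment is at least the slope at the far end of the step, which by
    Lipschitz continuity differs little from the slope at the near end. *)
Lemma smooth_increment H dH L y v t : tangent_bounds H dH ->
  lipschitz_on_cube L dH -> cube y -> cube (y + t *: v) -> vle 0 v -> 0 <= t ->
  t * dot (dH y) v - L * (t * l2norm v) ^+ 2 <= H (y + t *: v) - H y.
Proof.
move=> tb lip cy cyv v0 t0.
have yv : vle y (y + t *: v) by apply: vle_addr; exact: vle_scale.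
have /andP[+ _] := tb _ _ cy cyv yv; apply: le_trans.
rewrite [y + _ - y]addrC addKr lerBlDl -lerBlDr -dotZr -dotBl.
apply: le_trans (cauchy_schwarz _ _) _.
have := lip _ _ cy cyv.
rewrite opprD addrA subrr sub0r l2normN l2normZ// => le_norm.
by rewrite expr2 [leRHS]mulrA; apply: ler_wpM2r le_norm; rewrite mulr_ge0 ?l2norm_ge0.
Qed.

Definition rate H q : R := if `[< Defs.monotone H >] then 1 else q.

(** With [q < 1], the point [y + damp y o] lies on the segment from [o] to
    [o + damp o ((1 - q)^-1 *: y)], at a fraction [1 - q] of the way, and
    [H] is concave along that segment and nonnegative at its far end. *)
Lemma rate_le_damp H dH o y q : nonneg H -> tangent_bounds H dH ->
  cube o -> cube y -> 0 <= q <= 1 -> (forall i, y 0 i <= 1 - q) ->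
  rate H q * H o <= H (y + damp y o).
Proof.
move=> H0 tb co cy /andP[q0 q1] yq; rewrite /rate addr_dampC.
case: asboolP => [mono|_].
  by rewrite mul1r; apply: mono => //; [exact: cube_damp
    | apply: vle_addr; exact: damp_ge0].
have [q_eq1|q_neq1] := eqVneq q 1.
  have -> : y = 0.
    apply/rowP => i; rewrite mxE; apply/eqP; rewrite eq_le.
    have /andP[-> _] := cy i; rewrite andbT; have := yq i.
    by rewrite q_eq1 subrr.
  suff -> : damp o 0 = 0 by rewrite addr0 q_eq1 mul1r.
  by apply/rowP => i; rewrite !mxE mulr0.
have d0 : 0 < 1 - q by rewrite subr_gt0 lt_def eq_sym q_neq1.
pose w := (1 - q)^-1 *: y.
have cw : cube w.
  move=> i; rewrite mxE; have /andP[y0 _] := cy i.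
  by rewrite mulr_ge0 ?invr_ge0 ?(ltW d0)//= ler_pdivrMl// mulr1.
have w0 := damp_ge0 co cw.
set x := o + damp o y; pose z := o + damp o w.
have xE : damp o y = (1 - q) *: damp o w.
  by apply/rowP => i; rewrite !mxE [RHS]mulrCA mulVKf// ?gt_eqF.
have xo : x - o = (1 - q) *: damp o w by rewrite /x addrC addKr.
have zx : z - x = q *: damp o w.
  by rewrite /z /x xE opprD addrACA subrr add0r -{1}[damp o w]scale1r
    -scalerBl opprB addrC subrK.
have cx : cube x by exact: cube_damp.
have cz : cube z by exact: cube_damp.
have ox : vle o x by apply: vle_addr; exact: damp_ge0.
have xz : vle x z.
  by rewrite -[z](subrK x) addrC zx; apply: vle_addr; exact: vle_scale.
have /andP[+ _] := tb _ _ co cx ox; have /andP[_ +] := tb _ _ cx cz xz.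
rewrite zx xo !dotZr.
move: (dot _ _) => slope; have := H0 z cz.
(* Eliminate [slope]: [q] times the first bound plus [1 - q] times the second. *)
by move: (H x) (H z) (H o) => hx hz ho; nra.
Qed.

(** The discrete form of the differential inequality of continuous greedy. The
    two summands have to be treated together, since [s] is optimal only for the
    gradient of their sum. *)
Lemma measured_greedy_step (P : set 'rV[R]_n) (G C : 'rV[R]_n -> R)
    (dG dC dF : 'rV[R]_n -> 'rV[R]_n) L D o s y q eps :
  is_gradient G dG -> is_gradient C dC -> is_gradient (fun x => G x + C x) dF ->
  tangent_bounds G dG -> tangent_bounds C dC ->
  lipschitz_on_cube L dG -> lipschitz_on_cube L dC -> 0 <= L ->
  nonneg G -> nonneg C ->
  P `<=` cube -> P o -> argmax P (dot (damp y (dF y))) s -> l2norm s <= D ->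
  0 <= eps <= 1 -> cube y -> 0 <= q <= 1 -> (forall i, y 0 i <= 1 - q) ->
  let y' := y + eps *: damp y s in
  (1 - eps) * (G y + C y) + eps * (rate G q * G o + rate C q * C o)
    - 2 * eps ^+ 2 * L * D ^+ 2 <= G y' + C y'.
Proof.
move=> gG gC gF tG tC lG lC L0 G0 C0 Pc Po [Ps smax] sD eps01 cy q01 yq /=.
have co := Pc _ Po; have cs := Pc _ Ps; have /andP[e0 e1] := eps01.
have slopeE x : cube x -> dot (damp y (dF y)) x =
    dot (dG y) (damp y x) + dot (dC y) (damp y x).
  move=> cx; rewrite -dotDl.
  have := gradient_add gG gC gF cy (cube_damp cy cx).
  rewrite [y + _ - y]addrC addKr => <-.
  by apply: eq_bigr => i _; rewrite !mxE mulrAC mulrC mulrA mulrAC.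
have := smax o Po; rewrite !slopeE// => slope_le.
have toward H dH : tangent_bounds H dH -> nonneg H ->
    rate H q * H o - H y <= dot (dH y) (damp y o).
  move=> tH H0; have := rate_le_damp H0 tH co cy q01 yq.
  have /andP[_ +] := tH _ _ cy (cube_damp cy co) (vle_addr y (damp_ge0 cy co)).
  by rewrite [y + _ - y]addrC addKr; lra.
have incr H dH : tangent_bounds H dH -> lipschitz_on_cube L dH ->
    eps * dot (dH y) (damp y s) - eps ^+ 2 * L * D ^+ 2
      <= H (y + eps *: damp y s) - H y.
  move=> tH lH; apply: le_trans (smooth_increment tH lH cy
    (cube_damped_step cy cs eps01) (damp_ge0 cy cs) e0).
  rewrite lerD2l lerN2 exprMn mulrCA mulrA; apply: ler_wpM2l.
    by rewrite mulr_ge0// sqr_ge0.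
  rewrite ler_pXn2r ?nnegrE ?l2norm_ge0//; last exact: le_trans (l2norm_ge0 _) sD.
  exact: le_trans (l2norm_damp _ cy) sD.
have := incr _ _ tG lG; have := incr _ _ tC lC.
have := ler_wpM2l e0 (toward _ _ tG G0); have := ler_wpM2l e0 (toward _ _ tC C0).
have := ler_wpM2l e0 slope_le.
by rewrite !mulrDr; lra.
Qed.

(** * The approximation guarantee after several steps *)

(** The value at step [i] of the recurrence
    [x_(i+1) = (1 - eps) * x_i + eps * rate H ((1 - eps) ^+ i)], [x_0 = 0]. *)
Definition guarantee H eps (i : nat) : R :=
  if `[< Defs.monotone H >] then 1 - (1 - eps) ^+ i
  else i%:R * eps * (1 - eps) ^+ i.-1.

Lemma guarantee0 H eps : guarantee H eps 0 = 0.
Proof. by rewrite /guarantee; case: ifP => _; rewrite ?expr0 ?subrr ?mul0r. Qed.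

Lemma guaranteeS H eps i : guarantee H eps i.+1 =
  (1 - eps) * guarantee H eps i + eps * rate H ((1 - eps) ^+ i).
Proof.
rewrite /guarantee /rate; case: ifP => _; first by rewrite exprS; ring.
case: i => [|i] /=; first by rewrite !mul0r mulr0 add0r mul1r.
by rewrite exprS -[i.+2%:R]natr1; ring.
Qed.

(** [1 + x <= expR x] at [x = - eps] in the monotone case, and at
    [x = eps / (1 - eps)], where [1 + x = (1 - eps)^-1], in the other. *)
Lemma approx_factor_le_guarantee H eps (m : nat) : 0 < eps -> eps < 1 ->
  m%:R * eps = 1 -> approx_factor H <= guarantee H eps m.
Proof.
move=> e0 e1 me; rewrite /approx_factor /guarantee; case: ifP => _.
  have -> : -1 = m%:R * - eps :> R by rewrite mulrN me.
  rewrite lerD2l lerN2 expRM_natl.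
  have p0 : 0 <= 1 - eps by rewrite subr_ge0 ltW.
  by apply: lerXn2r; rewrite ?nnegrE ?expR_ge0//; exact: expR_ge1Dx.
have d0 : 0 < 1 - eps by rewrite subr_gt0.
rewrite me mul1r; case: m me => [|m] me; first by rewrite expr0 -expR0 ler_expR oppr_le0.
have -> : -1 = m%:R * - (eps / (1 - eps)) :> R.
  rewrite mulrN; congr (- _); rewrite mulrA.
  have -> : m%:R * eps = 1 - eps.
    by apply/eqP; rewrite eq_sym subr_eq -[X in _ + X]mul1r -mulrDl natr1 me.
  by rewrite divff ?gt_eqF.
rewrite expRM_natl /=; apply: lerXn2r; rewrite ?nnegrE ?expR_ge0 ?(ltW d0)//.
rewrite expRN -[leRHS]invrK lef_pV2 ?posrE ?expR_gt0 ?invr_gt0//.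
apply: le_trans (expR_ge1Dx _).
by rewrite -[X in _ <= X + _](divff (lt0r_neq0 d0)) -mulrDl subrK mul1r.
Qed.

End FrankWolfe.

Section Trajectory.
Context {R : realType} {n : nat} (P : set 'rV[R]_n) (G C : 'rV[R]_n -> R).
Context (dG dC dF : 'rV[R]_n -> 'rV[R]_n) (L D eps : R) (o : 'rV[R]_n).

(** The bound on the coordinates is part of the induction because it is what
    makes [(1 - eps) ^+ i] an admissible [q] in the next step. *)
Definition reached (i : nat) (y : 'rV[R]_n) :=
  [/\ cube y, forall j, y 0 j <= 1 - (1 - eps) ^+ i &
    guarantee G eps i * G o + guarantee C eps i * C o
      - i%:R * (2 * eps ^+ 2 * L * D ^+ 2) <= G y + C y].

Lemma reached0 : nonneg G -> nonneg C -> reached 0 0.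
Proof.
move=> G0 C0; have c0 : cube (0 : 'rV[R]_n) by move=> i; rewrite mxE lexx ler01.
split=> // [j|]; first by rewrite mxE expr0 subrr.
by rewrite !guarantee0 !mul0r addr0 subrr addr_ge0 ?G0 ?C0.
Qed.

Lemma reachedS i y s :
  is_gradient G dG -> is_gradient C dC -> is_gradient (fun x => G x + C x) dF ->
  tangent_bounds G dG -> tangent_bounds C dC ->
  lipschitz_on_cube L dG -> lipschitz_on_cube L dC -> 0 <= L ->
  nonneg G -> nonneg C -> P `<=` cube -> P o -> 0 <= eps <= 1 ->
  argmax P (dot (damp y (dF y))) s -> l2norm s <= D ->
  reached i y -> reached i.+1 (y + eps *: damp y s).
Proof.
move=> gG gC gF tG tC lG lC L0 G0 C0 Pc Po eps01 maxs sD [cy yi val].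
have /andP[e0 e1] := eps01; have cs : cube s by apply: Pc; case: maxs.
have d01 : 0 <= 1 - eps <= 1 by rewrite subr_ge0 e1 gerBl.
have q01 : 0 <= (1 - eps) ^+ i <= 1.
  by have /andP[? ?] := d01; rewrite exprn_ge0//= exprn_ile1.
split; first exact: cube_damped_step.
  move=> j; rewrite !mxE exprS; have /andP[s0 s1] := cs j.
  have /andP[y0 y1] := cy j; have := yi j; move: ((1 - eps) ^+ i) => q yq.
  apply: (@le_trans _ _ (y 0 j + eps * (1 - y 0 j))).
    by rewrite lerD2l; apply: ler_wpM2l => //; rewrite ler_piMr// subr_ge0.
  by nra.
have := measured_greedy_step gG gC gF tG tC lG lC L0 G0 C0 Pc Po maxs sD eps01
  cy q01 yi.
rewrite /=; apply: le_trans; rewrite !guaranteeS.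
have {val} := ler_wpM2l (proj1 (andP d01)) val.
have : 0 <= eps * (i%:R * (2 * eps ^+ 2 * L * D ^+ 2)).
  do 2!apply: mulr_ge0 => //; apply: mulr_ge0; last exact: sqr_ge0.
  by apply: mulr_ge0 => //; apply: mulr_ge0 => //; exact: sqr_ge0.
rewrite -natr1; move: (2 * eps ^+ 2 * L * D ^+ 2) => err.
move: (guarantee G eps i) (guarantee C eps i) (rate G _) (rate C _) => *.
by nra.
Qed.

Lemma reached_final (m : nat) y : 0 < eps -> eps < 1 -> m%:R * eps = 1 ->
  0 <= G o -> 0 <= C o -> reached m y ->
  approx_factor G * G o + approx_factor C * C o - 2 * (eps * L * D ^+ 2)
    <= G y + C y.
Proof.
move=> e0 e1 me Go Co [_ _]; apply: le_trans.
have -> : m%:R * (2 * eps ^+ 2 * L * D ^+ 2) = 2 * (eps * L * D ^+ 2).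
  by transitivity (m%:R * eps * (2 * (eps * L * D ^+ 2))); [ring | rewrite me mul1r].
by rewrite lerD2r; apply: lerD; apply: ler_wpM2r => //;
  exact: approx_factor_le_guarantee me.
Qed.

End Trajectory.

(** * Executing the program *)

Section Programs.
Context {R : realType} {n : nat}.
Context (solver : 'rV[R]_n -> 'rV[R]_n -> nat -> Prop).
Context (oracle : 'rV[R]_n -> 'rV[R]_n).

(** As the number [m] of iterations is known in advance, [m - i] serves as the
    termination measure. *)
Lemma ensures_while (Inv : nat -> state R -> Prop) g c Q (m : nat) :
  (forall i st, (i < m)%N -> Inv i st -> holds (n := n) st g /\
     ensures solver oracle c (tick (guard_cost g) st) (Inv i.+1)) ->
  (forall st, Inv m st -> ~~ holds (n := n) st g /\ Q (tick (guard_cost g) st)) ->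
  forall i st, (i <= m)%N -> Inv i st -> ensures solver oracle (While g c) st Q.
Proof.
move=> step done i st im; have [k] : exists k, (i + k = m)%N.
  by exists (m - i)%N; rewrite subnKC.
elim: k i st {im} => [|k IH] i st.
  by rewrite addn0 => -> /done[? ?]; exact: ensures_while_done.
move=> ikm inv; have im : (i < m)%N by lia.
have [g_true body] := step _ _ im inv.
by apply: (ensures_while_step g_true body) => st1; apply: IH; lia.
Qed.

(** Only cell [k] of [a] has to hold its initial value when the expression is
    evaluated for index [k], so the array may be updated in place. *)
Lemma ensures_for_dim_set (a i : nat) (e : expr) (st : state R)
    (v : 'rV[R]_n) (Q : state R -> Prop) :
  (forall (k : 'I_n) st1, var st1 = var st ->
     (forall a', a' != a -> arr st1 a' = arr st a') ->
     idx st1 i = k -> arr st1 a k = arr st a k -> Defs.eval st1 e = v 0 k) ->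
  (forall st1, var st1 = var st ->
     (forall a', a' != a -> arr st1 a' = arr st a') ->
     vec (arr st1 a) = v ->
     time st1 = (time st + (2 + n * (expr_cost e + 3)))%N ->
     grad_calls st1 = grad_calls st -> Q st1) ->
  ensures solver oracle (for_dim i (SetAt a i e)) st Q.
Proof.
move=> eE post; pose Inv k st1 := [/\ var st1 = var st,
  forall a', a' != a -> arr st1 a' = arr st a', idx st1 i = k,
  forall l : 'I_n, arr st1 a l = if (l < k)%N then v 0 l else arr st a l &
  time st1 = (time st + (1 + k * (expr_cost e + 3)))%N
    /\ grad_calls st1 = grad_calls st].
apply: (@ensures_seq _ _ _ _ _ _ _ (Inv 0%N)).
  apply: ensures_zero_idx; split=> //=; first by rewrite eqxx.
move=> st0; apply: (@ensures_while Inv _ _ _ n) => // {st0}.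
  move=> k st1 kn [varE arrE idxE aE [timeE callsE]].
  split; first by rewrite /= idxE.
  pose j := Ordinal kn.
  apply: (@ensures_seq _ _ _ _ _ _ _ (fun st2 => Inv k.+1
    (tick 1 (set_idx i (idx st2 i).+1 st2)))); last first.
    by move=> st2; exact: ensures_incr_idx.
  apply: ensures_set_at; split=> //=.
  - by move=> a' a'a; rewrite (negPf a'a) arrE.
  - by rewrite eqxx idxE.
  - move=> l; rewrite eqxx /= idxE ltnS leq_eqVlt.
    have [lk|lk] := eqVneq (l : nat) k; last exact: aE.
    have -> : l = j by exact: val_inj.
    by apply: eE => //=; have := aE j; rewrite /= ltnn.
  - by split=> //; rewrite timeE; lia.
move=> st1 [varE arrE idxE aE [timeE callsE]].
split; first by rewrite /= idxE ltnn.
apply: post => //=; last by rewrite timeE; lia.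
by apply/rowP => l; rewrite mxE aE ltn_ord.
Qed.

End Programs.

(** [Good] stands for whatever the analysis proves about the [i]-th iterate, so
    that the execution of the program and the analysis stay independent. *)
Lemma measured_greedy_fw_ensures (R : realType) (n : nat)
    (P : set 'rV[R]_n) (gradF : 'rV[R]_n -> 'rV[R]_n) (S : nat)
    (solver : 'rV[R]_n -> 'rV[R]_n -> nat -> Prop)
    (eps : R) (m : nat) (Good : nat -> 'rV[R]_n -> Prop) (st0 : state R)
    (Q : state R -> Prop) :
  solves_within S P solver -> 0 < eps -> m%:R * eps = 1 ->
  Good 0%N 0 ->
  (forall i y s, argmax P (dot (damp y (gradF y))) s ->
     Good i y -> Good i.+1 (y + eps *: damp y s)) ->
  var st0 v_eps = eps -> time st0 = 0%N -> grad_calls st0 = 0%N ->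
  (forall st, Good m (vec (arr st a_y)) ->
     (time st <= 7 + 4 * n + m * (11 + 20 * n + S))%N -> grad_calls st = m ->
     Q st) ->
  ensures solver gradF measured_greedy_fw st0 Q.
Proof.
move=> solves e0 me good0 goodS epsE time0 calls0 post.
pose Inv i (st : state R) := [/\ var st v_eps = eps, var st v_t = i%:R * eps,
  Good i (vec (arr st a_y)),
  (time st <= 4 + 4 * n + i * (11 + 20 * n + S))%N & grad_calls st = i].
(* 11 = 3 + 2 + 2 + 4 for the loop guard, the overhead of the two passes and the
   update of t; 20 = 8 + 12 for the body of the two passes. *)
apply: ensures_seq; first by apply: ensures_set_var; exact: erefl.
move=> _ <-; apply: (@ensures_seq _ _ _ _ _ _ _ (Inv 0%N)).
  apply: (@ensures_for_dim_set _ _ _ _ _ _ _ _ 0) => [k st1 *|].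
    by rewrite mxE.
  move=> st1 varE _ yE timeE callsE; split.
  - by rewrite varE.
  - by rewrite varE mul0r.
  - by rewrite yE.
  - by rewrite timeE /= time0; lia.
  - by rewrite callsE.
move=> st; apply: (@ensures_while _ _ _ _ Inv _ _ _ m) => // {st}; last first.
  move=> st [_ tE good timeE callsE]; rewrite /= tE me ltxx; split=> //.
  by apply: post => //=; lia.
move=> i st im [epsE' tE good timeE callsE].
have lt1 : var st v_t < 1 by rewrite tE -[ltRHS]me ltr_pM2r// ltr_nat.
split=> //=.
set y : 'rV[R]_n := vec (arr st a_y) in good.
apply: (@ensures_seq _ _ _ _ _ _ _ (fun st1 => exists2 g,
    vec g = gradF y & st1 = count_grad (set_arr a_g g (tick 3 st)))).
  by apply: ensures_grad => g gE; exists g.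
move=> _ [g gE ->]; apply: (@ensures_seq _ _ _ _ _ _ _ (fun st1 => [/\
    var st1 = var st, arr st1 a_y = arr st a_y,
    vec (arr st1 a_w) = damp y (gradF y),
    time st1 = (time st + 3 + (2 + n * 8))%N &
    grad_calls st1 = (grad_calls st).+1])).
  apply: (@ensures_for_dim_set _ _ _ _ _ _ _ _ (damp y (gradF y))).
    move=> k st1 varE arrE idxE wE /=.
    by rewrite idxE !arrE//= !mxE -gE mxE.
  by move=> st1 varE arrE wE timeE1 callsE1; split=> //; rewrite arrE.
move=> st1 [varE1 yE1 wE1 timeE1 callsE1].
apply: (@ensures_seq _ _ _ _ _ _ _ (fun st2 => exists s tau,
    solver (damp y (gradF y)) (vec s) tau /\
    st2 = tick tau (set_arr a_s s st1))).
  apply: ensures_lin_max; rewrite wE1; first by case: (solves (damp y (gradF y))).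
  by move=> s tau run; exists s, tau.
move=> _ [s [tau [run ->]]].
have [_ /(_ _ _ run)[maxs tauS]] := solves (damp y (gradF y)).
apply: (@ensures_seq _ _ _ _ _ _ _ (fun st2 => [/\
    var st2 = var st, vec (arr st2 a_y) = y + eps *: damp y (vec s),
    time st2 = (time st1 + tau + (2 + n * 12))%N &
    grad_calls st2 = grad_calls st1])).
  apply: (@ensures_for_dim_set _ _ _ _ _ _ _ _ (y + eps *: damp y (vec s))).
    move=> k st2 varE arrE idxE yE /=.
    by rewrite idxE yE !arrE//= varE /= varE1 /= epsE' yE1 !mxE.
  by move=> st2 varE arrE yE timeE2 callsE2; split=> //; rewrite varE.
move=> st2 [varE2 yE2 timeE2 callsE2].
apply: ensures_set_var; split=> /=.
- by rewrite varE2.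
- by rewrite varE2 tE epsE' -natr1 mulrDl mul1r.
- by rewrite yE2; exact: goodS.
- by rewrite timeE2 timeE1; lia.
- by rewrite callsE2 callsE1 callsE.
Qed.

Theorem theorem3p7 (R : realType) :
  exists c_time c_calls c_err : R,
  forall (n : nat) (P : set 'rV[R]_n) (G C : 'rV[R]_n -> R) (L : R)
    (F := fun x => G x + C x) (gradF : 'rV[R]_n -> 'rV[R]_n)
    (o : 'rV[R]_n) (D eps : R) (S : nat)
    (solver : 'rV[R]_n -> 'rV[R]_n -> nat -> Prop) (st0 : state R),
  (0 < n)%N ->
  P `<=` cube -> convex_body P -> down_closed P -> solves_within S P solver ->
  nonneg G -> smooth L G -> dr_submodular G ->
  nonneg C -> smooth L C -> concave C ->
  is_gradient F gradF ->
  argmax P F o ->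
  (exists2 d, argmax P l2norm d & D = l2norm d) ->
  0 < eps -> eps < 1 -> eps^-1 \is a Num.int ->
  var st0 v_eps = eps -> time st0 = 0%N -> grad_calls st0 = 0%N ->
  ensures solver gradF measured_greedy_fw st0
    (fun st => let y : 'rV[R]_n := vec (arr st a_y) in
      [/\ (time st)%:R <= c_time * (eps^-1 * (n + S)%:R),
          (grad_calls st)%:R <= c_calls * eps^-1 &
          approx_factor G * G o + approx_factor C * C o - c_err * (eps * L * D ^+ 2)
            <= F y]).
Proof.
(* The time is at most 7 + 4 n + m (11 + 20 n + S), where 1 <= n and 1 <= m. *)
exists 42, 1, 2 => n P G C L F gradF o D eps S solver st0 n0 Pc _ _ solves G0.
move=> [dG gG lG] drG C0 [dC gC lC] concC gF [Po _] [d [Pd maxd] ->] e0 e1.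
rewrite intrEge0 ?invr_ge0 ?(ltW e0)// => /natrP[m mE] epsE time0 calls0.
have me : m%:R * eps = 1 by rewrite -mE mulVf// gt_eqF.
have m0 : (0 < m)%N by rewrite -(ltr0n R) -mE invr_gt0.
have tG := dr_tangent_bounds gG drG; have tC := concave_tangent_bounds gC concC.
have L0 := lipschitz_on_cube_ge0 n0 lG.
have eps01 : 0 <= eps <= 1 by rewrite !ltW.
apply: (measured_greedy_fw_ensures (m := m)
  (Good := reached G C L (l2norm d) eps o) solves e0 me) => //.
- exact: reached0.
- move=> i y s maxs; apply: (reachedS gG gC gF tG tC lG lC L0 G0 C0 Pc Po eps01 maxs).
  by apply: maxd; case: maxs.
move=> st good time_le callsE; split.
- rewrite mE -!natrM ler_nat; apply: leq_trans time_le _.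
  have : (n + S <= m * (n + S))%N by rewrite leq_pmull.
  by nia.
- by rewrite callsE mE mul1r.
- by apply: (reached_final e0 e1 me _ _ good); [apply: G0 | apply: C0]; apply: Pc.
Qed.
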